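(* Let $\hbar>0$, $\delta\in\mathbb{R}$, let $\mathcal{F}$ be an $\hbar$-invariant $\ast$-subalgebra of $F(\mathbb{R},\mathbb{C})$ separating points of $\mathbb{R}$, and let $f\in\mathcal{F}$ be such that the functions $u\mapsto f(u\pm\tfrac12\hbar)$ belong to $\mathcal{F}$. Let $\mathcal{A}_\hbar(\mathcal{F},f)$ be the shift subalgebra generated by $A_+=f(u-\tfrac12\hbar)U^{-1}$ and $A_-=f(u+\tfrac12\hbar)U$, and for $k\in\mathbb{Z}$ let $\mathcal{S}_\hbar^\delta(|k\rangle)$ be the $\mathcal{A}_\hbar(\mathcal{F},f)$-module generated by $|k\rangle$ in $\mathcal{S}_\hbar(\mathbb{1},\delta)$. (1) If $f\big((N+\tfrac12+\delta)\hbar\big)=0$ for some $N\in\mathbb{Z}$ and $f\big((n+\tfrac12+\delta)\hbar\big)\ne0$ for all integers $n<N$, then $\mathcal{S}_\hbar^\delta(|N\rangle)=\{\sum_{n\le N}v_n|n\rangle: v_n\in\mathbb{C},\ v_n\neq 0\text{ for only finitely many }n\}$. (2) If $f\big((M-\tfrac12+\delta)\hbar\big)=0$ for some $M\in\mathbb{Z}$ and $f\big((n-\tfrac12+\delta)\hbar\big)\ne0$ for all integers $n>M$, then $\mathcal{S}_\hbar^\delta(|M\rangle)=\{\sum_{n\ge M}v_n|n\rangle: v_n\in\mathbb{C},\ v_n\neq 0\text{ for only finitely many }n\}$. (3) If $f\big((M-\tfrac12+\delta)\hbar\big)=0$ and $f\big((N+\tfrac12+\delta)\hbar\big)=0$ for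 some $M,N\in\mathbb{Z}$ with $M<N$, and $f\big((n+\tfrac12+\delta)\hbar\big)\ne0$ for all integers $M\le n<N$, then $\mathcal{S}_\hbar^\delta(|M\rangle)=\mathcal{S}_\hbar^\delta(|N\rangle)=\{\sum_{M\le n\le N}v_n|n\rangle: v_n\in\mathbb{C}\}$.
   Context: $F(\mathbb{R},\mathbb{C})$ is the $\ast$-algebra of all complex valued functions on $\mathbb{R}$ (involution = complex conjugation). A $\ast$-subalgebra $\mathcal{F}$ is $\hbar$-invariant if $u\mapsto g(u+k\hbar)$ is in $\mathcal{F}$ for all $g\in\mathcal{F}$, $k\in\mathbb{Z}$; it separates points if for distinct $x,y\in\mathbb{R}$ there is $g\in\mathcal{F}$ with $g(x)\neq g(y)$. The (one-dimensional) shift algebra consists of finite formal sums $\sum_{k\in\mathbb{Z}}f_kU^k$, $f_k\in\mathcal{F}$, with product $(f_kU^k)(g_lU^l)=f_k(u)g_l(u+k\hbar)U^{k+l}$ and involution $(f_kU^k)^\ast=\overline{f_k(u-k\hbar)}\,U^{-k}$, extended additively. A shift subalgebra is a $\ast$-subalgebra $\mathcal{A}$ of it such that $ga\in\mathcal{A}$ for all $g\in\mathcal{F}$, $a\in\mathcal{A}$; the shift subalgebra generated by a set is the smallest one containing it. $\mathcal{S}_\hbar(\mathbb{1},\delta)$ is the left module over the shift algebra with vector space basis $\{|k\rangle\}_{k\in\mathbb{Z}}$ and action $(\sum_nf_nU^n)|k\rangle=\sum_nf_n\big((k-n+\delta)\hbar\big)|k-n\rangle$. The $\mathcal{A}$-module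 generated by $|k\rangle$ is the smallest $\mathcal{A}$-invariant linear subspace containing $|k\rangle$. In particular $A_+|n\rangle=f\big((n+\tfrac12+\delta)\hbar\big)|n+1\rangle$ and $A_-|n\rangle=f\big((n-\tfrac12+\delta)\hbar\big)|n-1\rangle$. *)

(* Defs.v *)
From HB Require Import structures.
From mathcomp Require Import all_boot all_order all_algebra ring.
From mathcomp Require Import finmap.
From mathcomp Require Import boolp classical_sets functions reals.
From mathcomp Require Import complex.
From mathcomp.multinomials Require Import monalg.

Set Implicit Arguments.
Unset Strict Implicit.
Unset Printing Implicit Defensive.

Import Order.TTheory GRing.Theory Num.Theory.

Local Open Scope classical_set_scope.
Local Open Scope ring_scope.

(* Neither *-subalgebras of functions nor shift subalgebras are required to  *)
(* contain a unit.                                                            *)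
Definition star_subalgebra (R : realType) (F : set (R -> R[i])) : Prop :=
  [/\ F (fun=> 0),
      forall g h, F g -> F h -> F (fun u => g u + h u),
      forall (c : R[i]) g, F g -> F (fun u => c * g u),
      forall g h, F g -> F h -> F (fun u => g u * h u)
    & forall g, F g -> F (fun u => (g u)^*)].

Definition hbar_invariant (R : realType) (hbar : R) (F : set (R -> R[i])) :
    Prop :=
  forall g (k : int), F g -> F (fun u => g (u + k%:~R * hbar)).

Definition separates_points (R : realType) (F : set (R -> R[i])) : Prop :=
  forall x y : R, x <> y -> exists2 g, F g & g x <> g y.

(* The finite formal sum \sum_k f_k U^k is the finitely supported function    *)
(* k |-> f_k, so that << f *g k >> is f U^k and a@_k is the coefficient of    *)
(* U^k in a. Coefficients are arbitrary functions here; shift_algebra F below *)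
(* is the set of the sums with coefficients in F. The ring structure that     *)
(* monalg puts on some {malg _[_]} is not used: the product is twisted.       *)
Definition shift_sum (R : realType) := {malg (R -> R[i])[int]}.

Section ShiftOperations.
Variables (R : realType) (hbar : R).
Implicit Types a b : shift_sum R.

Definition shift_mul a b : shift_sum R :=
  \sum_(k <- msupp a) \sum_(l <- msupp b)
    << (fun u : R => a@_k u * b@_l (u + k%:~R * hbar)) *g k + l >>.

Definition shift_star a : shift_sum R :=
  \sum_(k <- msupp a)
    << (fun u : R => (a@_k (u - k%:~R * hbar))^*) *g - k >>.

(* g a, that is (g U^0) a *)
Definition shift_lmul (g : R -> R[i]) a : shift_sum R :=
  shift_mul << g *g 0 >> a.

Definition shift_algebra (F : set (R -> R[i])) : set (shift_sum R) :=
  [set a | forall k, F a@_k].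

Definition shift_subalgebra (F : set (R -> R[i])) (A : set (shift_sum R)) :
    Prop :=
  A `<=` shift_algebra F /\
  [/\ A 0,
      forall a b, A a -> A b -> A (a + b),
      forall (c : R[i]) a, A a -> A (shift_lmul (fun=> c) a),
      forall a b, A a -> A b -> A (shift_mul a b)
    & forall a, A a -> A (shift_star a)] /\
  forall g a, F g -> A a -> A (shift_lmul g a).

Definition generated_shift_subalgebra (F : set (R -> R[i]))
    (X : set (shift_sum R)) : set (shift_sum R) :=
  smallest (shift_subalgebra F) X.

Definition Aplus (f : R -> R[i]) : shift_sum R :=
  << (fun u : R => f (u - 2^-1 * hbar)) *g -1 >>.

Definition Aminus (f : R -> R[i]) : shift_sum R :=
  << (fun u : R => f (u + 2^-1 * hbar)) *g 1 >>.

Definition Ahbar (F : set (R -> R[i])) (f : R -> R[i]) : set (shift_sum R) :=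
  generated_shift_subalgebra F [set a | a = Aplus f \/ a = Aminus f].

End ShiftOperations.

(* The vector space with basis (|k>)_(k : int). *)
Definition ket_space (R : realType) := {malg R[i][int]}.

Definition ket (R : realType) (k : int) : ket_space R := << (1 : R[i]) *g k >>.

Section KetModule.
Variables (R : realType) (hbar delta : R).
Implicit Types (a : shift_sum R) (v : ket_space R).

Definition ket_act a v : ket_space R :=
  \sum_(k <- msupp v)
    v@_k *: \sum_(n <- msupp a)
              a@_n (((k - n)%:~R + delta) * hbar) *: ket R (k - n).

Definition invariant_subspace (A : set (shift_sum R)) (V : set (ket_space R)) :
    Prop :=
  [/\ V 0,
      forall v w, V v -> V w -> V (v + w),
      forall (c : R[i]) v, V v -> V (c *: v)
    & forall a v, A a -> V v -> V (ket_act a v)].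

Definition ket_module (F : set (R -> R[i])) (f : R -> R[i]) (k : int) :
    set (ket_space R) :=
  smallest (invariant_subspace (Ahbar hbar F f)) [set ket R k].

End KetModule.

(* All the finite sums \sum_n v_n |n> over the n satisfying P. *)
Definition ket_sums (R : realType) (P : set int) : set (ket_space R) :=
  [set v : ket_space R | forall n, v@_n != 0 -> P n].

(* The operations are the (bi)additive extensions of the formulas that define *)
(* them on monomials.                                                         *)
Section OperationFormulas.
Variables (R : realType) (hbar delta : R).

Lemma sum_msuppw (K : choiceType) (G V : zmodType) (F : K -> G -> V)
    (g : {malg G[K]}) (d : {fset K}) :
  (forall k, F k 0 = 0) -> (msupp g `<=` d)%fset ->
  \sum_(k <- msupp g) F k g@_k = \sum_(k <- d) F k g@_k.
Proof.
move=> F0 sgd; apply/big_fset_incl => // k _ /mcoeff_outdom ->; exact: F0.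
Qed.

Lemma sum_msuppD (K : choiceType) (G V : zmodType) (F : K -> G -> V)
    (g h : {malg G[K]}) :
  (forall k, F k 0 = 0) -> (forall k x y, F k (x + y) = F k x + F k y) ->
  \sum_(k <- msupp (g + h)) F k (g + h)@_k =
  \sum_(k <- msupp g) F k g@_k + \sum_(k <- msupp h) F k h@_k.
Proof.
move=> F0 FD.
rewrite (sum_msuppw F0 (msuppD_le g h)) (sum_msuppw F0 (fsubsetUl _ (msupp h))).
rewrite (sum_msuppw F0 (fsubsetUr (msupp g) _)) -big_split /=.
by apply: eq_bigr => k _; rewrite mcoeffD FD.
Qed.

Lemma sum_msuppU (K : choiceType) (G V : zmodType) (F : K -> G -> V) k x :
  (forall k, F k 0 = 0) ->
  \sum_(j <- msupp << x *g k >>) F j (<< x *g k >>)@_j = F k x.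
Proof.
move=> F0; rewrite (sum_msuppw F0 msuppU_le) big_seq_fset1 mcoeffUU //.
Qed.

Let mulF (k l : int) (g h : R -> R[i]) : shift_sum R :=
  << (fun u : R => g u * h (u + k%:~R * hbar)) *g k + l >>.

Let mulF0l k l h : mulF k l 0 h = 0.
Proof.
rewrite /mulF -[RHS](monalgU0 (k + l)); congr mkmalgU.
by apply/funext => u; rewrite mul0r.
Qed.

Let mulF0r k l g : mulF k l g 0 = 0.
Proof.
rewrite /mulF -[RHS](monalgU0 (k + l)); congr mkmalgU.
by apply/funext => u; rewrite mulr0.
Qed.

Let mulFDl k l g1 g2 h : mulF k l (g1 + g2) h = mulF k l g1 h + mulF k l g2 h.
Proof.
rewrite /mulF -monalgUD; congr mkmalgU.
by apply/funext => u; rewrite mulrDl.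
Qed.

Let mulFDr k l g h1 h2 : mulF k l g (h1 + h2) = mulF k l g h1 + mulF k l g h2.
Proof.
rewrite /mulF -monalgUD; congr mkmalgU.
by apply/funext => u; rewrite mulrDr.
Qed.

Lemma shift_mulUU k l (g h : R -> R[i]) :
  shift_mul hbar << g *g k >> << h *g l >> =
  << (fun u : R => g u * h (u + k%:~R * hbar)) *g k + l >>.
Proof.
rewrite /shift_mul.
rewrite (@sum_msuppU _ _ _ (fun k x => \sum_(l' <- msupp << h *g l >>)
  mulF k l' x (<< h *g l >>)@_l')).
  by rewrite (@sum_msuppU _ _ _ (fun l' y => mulF k l' g y)).
by move=> k'; rewrite big1 // => l' _; rewrite mulF0l.
Qed.

Lemma shift_mulDl : left_distributive (@shift_mul R hbar) +%R.
Proof.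
move=> a1 a2 b; apply: (@sum_msuppD _ _ _ (fun k x => \sum_(l <- msupp b)
  mulF k l x b@_l)) => [k | k x y].
  by rewrite big1 // => l _; rewrite mulF0l.
by rewrite -big_split; apply: eq_bigr => l _; rewrite mulFDl.
Qed.

Lemma shift_mulDr : right_distributive (@shift_mul R hbar) +%R.
Proof.
move=> a b1 b2; rewrite /shift_mul -big_split; apply: eq_bigr => k _ /=.
apply: (@sum_msuppD _ _ _ (fun l y => mulF k l a@_k y)) => [l | l x y].
  by rewrite mulF0r.
by rewrite mulFDr.
Qed.

Lemma shift_starU k (g : R -> R[i]) :
  shift_star hbar << g *g k >> =
  << (fun u : R => (g (u - k%:~R * hbar))^*) *g - k >>.
Proof.
apply: (@sum_msuppU _ _ _ (fun k g =>
  << (fun u : R => (g (u - k%:~R * hbar))^*) *g - k >> : shift_sum R)) => l.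
rewrite -[RHS](monalgU0 (- l)); congr mkmalgU.
by apply/funext => u; rewrite rmorph0.
Qed.

Lemma shift_starD : {morph @shift_star R hbar : a b / a + b}.
Proof.
move=> a b; apply: (@sum_msuppD _ _ _ (fun k g =>
  << (fun u : R => (g (u - k%:~R * hbar))^*) *g - k >> : shift_sum R)).
  move=> l; rewrite -[RHS](monalgU0 (- l)); congr mkmalgU.
  by apply/funext => u; rewrite rmorph0.
move=> l x y; rewrite -monalgUD; congr mkmalgU.
by apply/funext => u; rewrite rmorphD.
Qed.

Lemma ket_act_ket (a : shift_sum R) (k : int) :
  ket_act hbar delta a (ket R k) =
  \sum_(n <- msupp a) a@_n (((k - n)%:~R + delta) * hbar) *: ket R (k - n).
Proof.
rewrite /ket_act /ket (@sum_msuppU _ _ _ (fun (k : int) (x : R[i]) =>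
  x *: \sum_(n <- msupp a)
         a@_n (((k - n)%:~R + delta) * hbar) *: ket R (k - n))).
  by rewrite scale1r.
by move=> j; rewrite scale0r.
Qed.

Lemma ket_actDr (a : shift_sum R) :
  {morph ket_act hbar delta a : v w / v + w}.
Proof.
move=> v w; apply: (@sum_msuppD _ _ _ (fun (k : int) (x : R[i]) =>
  x *: \sum_(n <- msupp a)
         a@_n (((k - n)%:~R + delta) * hbar) *: ket R (k - n))).
  by move=> j; rewrite scale0r.
by move=> j x y; rewrite scalerDl.
Qed.

Lemma ket_actU_ket (g : R -> R[i]) (n k : int) :
  ket_act hbar delta << g *g n >> (ket R k) =
  g (((k - n)%:~R + delta) * hbar) *: ket R (k - n).
Proof.
rewrite ket_act_ket (@sum_msuppU _ _ _ (fun (n : int) (g : R -> R[i]) =>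
   g (((k - n)%:~R + delta) * hbar) *: ket R (k - n))) // => j.
by rewrite scale0r.
Qed.

Lemma Aplus_ket (f : R -> R[i]) (n : int) :
  ket_act hbar delta (Aplus hbar f) (ket R n) =
  f ((n%:~R + 2^-1 + delta) * hbar) *: ket R (n + 1).
Proof.
rewrite ket_actU_ket opprK -mulrBl rmorphD /=; congr (f (_ * _) *: _).
by field.
Qed.

Lemma Aminus_ket (f : R -> R[i]) (n : int) :
  ket_act hbar delta (Aminus hbar f) (ket R n) =
  f ((n%:~R - 2^-1 + delta) * hbar) *: ket R (n - 1).
Proof.
rewrite ket_actU_ket -mulrDl rmorphB /=; congr (f (_ * _) *: _).
by field.
Qed.

End OperationFormulas.

(* Main.v *)
(* A ladder operator carries |n> to a multiple of a neighbouring ket, and     *)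
(* the coefficient of both transitions |n> <-> |n+1> is f((n+1/2+delta)hbar). *)
(* Nonzero coefficients let the generated module reach every ket of an        *)
(* interval. Conversely, let f vanish at the transitions that cross the       *)
(* boundary of a set P of indices. The shift sums that leave both P and its   *)
(* complement invariant form a shift subalgebra containing the ladder         *)
(* operators (the involution exchanges P and its complement, so that the      *)
(* invariance of P alone would not be stable), hence the generated module     *)
(* stays in the span of P.                                                    *)
Require Import Defs.
From mathcomp Require Import all_boot all_order all_algebra.
From mathcomp Require Import boolp classical_sets functions reals.
From mathcomp Require Import complex.
From mathcomp Require Import finmap zify ring.
From mathcomp.multinomials Require Import monalg.

Set Implicit Arguments.
Unset Strict Implicit.

Import Order.TTheory GRing.Theory Num.Theory.
Local Open Scope classical_set_scope.
Local Open Scope ring_scope.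

(** All three claims are instances of [ket_moduleE]: let f((n+1/2+delta)hbar) be the weight of the
    edge between n and n+1. If the weight vanishes on each edge with exactly one end in P, and on no
    edge between k and a point of P, then |k> generates the span of P. The upper bound
    [ket_module_sub] uses minimality twice: the generated algebra lies in the block-diagonal sums
    [block_sum], and these preserve the span of P, so it contains the generated module. The lower
    bound, [invariant_ket_interval], walks along edges of nonzero weight, dividing by each
    weight. *)

Section BlockDiagonal.
Variables (R : realType) (hbar delta : R) (F : set (R -> R[i])) (P : set int).
Hypotheses (F_alg : star_subalgebra F) (F_inv : hbar_invariant hbar F).
Implicit Types (g h : R -> R[i]) (a b : shift_sum R).

(** The constraint on g U^n: its matrix entry from |k> to |k-n> vanishes whenever exactly one of the
    two indices lies in P. *)
Definition block_coeff (n : int) : set (R -> R[i]) :=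
  [set g | F g /\ forall k : int, ~ (P k <-> P (k - n)) ->
                    g (((k - n)%:~R + delta) * hbar) = 0].

Definition block_sum : set (shift_sum R) :=
  [set a | forall n, block_coeff n a@_n].

Lemma block_coeff0 n : block_coeff n (fun=> 0).
Proof. by case: F_alg. Qed.

Lemma block_coeffD n g h :
  block_coeff n g -> block_coeff n h -> block_coeff n (fun u => g u + h u).
Proof.
case: F_alg => _ FD _ _ _ [Fg Pg] [Fh Ph]; split; first exact: FD.
by move=> k Pk; rewrite Pg ?Ph ?addr0.
Qed.

(** Constants are treated beside F, which may lack a unit, so that one statement serves both scalar
    multiples and the action of F. *)
Lemma block_coeffM n g h : F h \/ (exists c, h = fun=> c) ->
  block_coeff n g -> block_coeff n (fun u => h u * g u).
Proof.
case: F_alg => _ _ FZ FM _ hh [Fg Pg]; split=> [|k Pk].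
  by case: hh => [Fh | [c ->]]; [exact: FM | exact: FZ].
by rewrite Pg ?mulr0.
Qed.

(** A path j, j-l, j-l-k that ends on the other side of P changes sides in one of its two steps, and
    that step contributes a zero factor. *)
Lemma block_coeff_mul k l g h : block_coeff k g -> block_coeff l h ->
  block_coeff (k + l) (fun u => g u * h (u + k%:~R * hbar)).
Proof.
case: F_alg => _ _ _ FM _ [Fg Pg] [Fh Ph].
split=> [|j Pj]; first by apply: FM => //; exact: F_inv.
have -> : ((j - (k + l))%:~R + delta) * hbar + k%:~R * hbar
          = ((j - l)%:~R + delta) * hbar :> R.
  by rewrite -mulrDl !rmorphB rmorphD /=; congr (_ * _); ring.
have [Pjl | nPjl] := pselect (P j <-> P (j - l)); last by rewrite Ph ?mulr0.
have e : j - (k + l) = j - l - k by ring.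
rewrite e Pg ?mul0r // => Pjlk; apply: Pj; rewrite e.
by split=> [/Pjl/Pjlk | /Pjlk/Pjl].
Qed.

(** The involution reverses each transition and conjugates its entry; the constraint is symmetric in
    the two ends. *)
Lemma block_coeff_star n g : block_coeff n g ->
  block_coeff (- n) (fun u => (g (u - n%:~R * hbar))^*).
Proof.
case: F_alg => _ _ _ _ FC [Fg Pg]; split=> [|k Pk].
  apply: FC; have := @F_inv g (- n) Fg.
  by under eq_fun do rewrite rmorphN mulNr.
have -> : ((k - - n)%:~R + delta) * hbar - n%:~R * hbar
          = ((k + n - n)%:~R + delta) * hbar :> R.
  by rewrite -mulrBl opprK addrK rmorphD /=; congr (_ * _); ring.
rewrite Pg ?rmorph0 // addrK => Pkn; apply: Pk; rewrite opprK.
by split=> /Pkn.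
Qed.

Lemma block_sum0 : block_sum 0.
Proof. by move=> n; rewrite mcoeff0; exact: block_coeff0. Qed.

Lemma block_sumD a b : block_sum a -> block_sum b -> block_sum (a + b).
Proof. by move=> Ba Bb n; rewrite mcoeffD; exact: block_coeffD. Qed.

Lemma block_sumU n g : block_coeff n g -> block_sum << g *g n >>.
Proof.
move=> Bg k; rewrite mcoeffU; case: eqP => [<- | _]; first by rewrite mulr1n.
by rewrite mulr0n; exact: block_coeff0.
Qed.

Lemma block_sum_big (I : Type) (r : seq I) (a : I -> shift_sum R) :
  (forall i, block_sum (a i)) -> block_sum (\sum_(i <- r) a i).
Proof.
move=> Ba; elim/big_rec: _ => [|i b _ Bb]; first exact: block_sum0.
exact: block_sumD.
Qed.

Lemma block_sum_lmul g a : F g \/ (exists c, g = fun=> c) ->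
  block_sum a -> block_sum (shift_lmul hbar g a).
Proof.
move=> hg Ba; rewrite /shift_lmul /shift_mul.
apply: block_sum_big => k; apply: block_sum_big => l; apply: block_sumU.
rewrite mcoeffU; case: eqP => [<- | _].
  rewrite add0r mulr1n; under eq_fun do rewrite mul0r addr0.
  exact: block_coeffM.
by rewrite mulr0n; under eq_fun do rewrite mul0r; exact: block_coeff0.
Qed.

Lemma block_sum_shift_subalgebra : shift_subalgebra hbar F block_sum.
Proof.
split=> [a Ba k | ]; first by case: (Ba k).
split; last by move=> g a Fg; apply: block_sum_lmul; left.
split.
- exact: block_sum0.
- exact: block_sumD.
- by move=> c a; apply: block_sum_lmul; right; exists c.
- move=> a b Ba Bb; apply: block_sum_big => k; apply: block_sum_big => l.
  by apply: block_sumU; exact: block_coeff_mul.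
- move=> a Ba; apply: block_sum_big => k; apply: block_sumU.
  exact: block_coeff_star.
Qed.

End BlockDiagonal.

(** * Spans of sets of kets *)

Section KetSums.
Variable R : realType.
Implicit Types (P : set int) (v w : ket_space R) (V : set (ket_space R)).

Lemma ket_sums0 P : ket_sums P (0 : ket_space R).
Proof. by move=> n; rewrite mcoeff0 eqxx. Qed.

Lemma ket_sumsD P v w : ket_sums P v -> ket_sums P w -> ket_sums P (v + w).
Proof.
move=> Pv Pw n; rewrite mcoeffD.
have [-> | /Pv //] := eqVneq v@_n 0; rewrite add0r; exact: Pw.
Qed.

Lemma ket_sumsZ P (c : R[i]) v : ket_sums P v -> ket_sums P (c *: v).
Proof.
move=> Pv n; rewrite mcoeffZ => cv; apply: Pv; apply: contra_neq cv => ->.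
exact: mulr0.
Qed.

Lemma ket_sums_ket P n : P n -> ket_sums P (ket R n).
Proof.
move=> Pn k; rewrite mcoeffU; have [<- // | _] := eqVneq n k.
by rewrite mulr0n eqxx.
Qed.

Lemma ket_sums_big P (I : eqType) (r : seq I) (v : I -> ket_space R) :
  (forall i, i \in r -> ket_sums P (v i)) -> ket_sums P (\sum_(i <- r) v i).
Proof.
move=> Pv; rewrite big_seq; elim/big_rec: _ => [|i w ri Pw].
  exact: ket_sums0.
by apply: ket_sumsD => //; exact: Pv.
Qed.

Lemma ket_decomposition v : v = \sum_(k <- msupp v) v@_k *: ket R k.
Proof.
rewrite [LHS]monalgE; apply: eq_bigr => k _; apply/malgP => n.
by rewrite mcoeffZ !mcoeffU; case: eqP => _; rewrite ?mulr1 ?mulr0.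
Qed.

Lemma ket_sums_sub P V : V 0 -> (forall v w, V v -> V w -> V (v + w)) ->
  (forall (c : R[i]) v, V v -> V (c *: v)) ->
  (forall n, P n -> V (ket R n)) -> ket_sums P `<=` V.
Proof.
move=> V0 VD VZ Vket v Pv; rewrite (ket_decomposition v) big_seq.
elim/big_rec: _ => [//|k w kv Vw]; apply: VD => //; apply: VZ; apply: Vket.
by apply: Pv; rewrite mcoeff_neq0.
Qed.

End KetSums.

(** * The module generated by a ket *)

Section KetModule.
Variables (R : realType) (hbar delta : R) (F : set (R -> R[i])) (f : R -> R[i]).

Let c (n : int) : R[i] := f ((n%:~R + 2^-1 + delta) * hbar).

Lemma ket_module_sub (P : set int) (k : int) :
  star_subalgebra F -> hbar_invariant hbar F ->
  F (fun u => f (u + 2^-1 * hbar)) -> F (fun u => f (u - 2^-1 * hbar)) ->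
  (forall n, ~ (P n <-> P (n + 1)) -> c n = 0) -> P k ->
  ket_module hbar delta F f k `<=` @ket_sums R P.
Proof.
move=> F_alg F_inv Fp Fm cP Pk v; apply; split; last first.
  by move=> _ ->; exact: ket_sums_ket.
split.
- exact: ket_sums0.
- exact: ket_sumsD.
- exact: ket_sumsZ.
move=> a w Aa Pw; have {Aa} Ba : block_sum hbar delta F P a.
  apply: Aa; split; first exact: block_sum_shift_subalgebra.
  move=> _ [] ->; apply: block_sumU => //; split=> // j Pj.
  (* [Aplus] crosses the edge from j to j+1, of weight [c j]. *)
  + rewrite opprK in Pj *; rewrite -(cP j Pj) /c rmorphD /= -mulrBl.
    by congr (f (_ * _)); field.
  (* [Aminus] crosses the edge from j down to j-1, of weight [c (j - 1)]. *)
  + have {}Pj : ~ (P (j - 1) <-> P (j - 1 + 1)).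
      by rewrite subrK => Pj1; apply: Pj; split=> /Pj1.
    rewrite -(cP _ Pj) /c -mulrDl.
    by congr (f (_ * _)); ring.
apply: ket_sums_big => j; rewrite -mcoeff_neq0 => /Pw Pj; apply: ket_sumsZ.
apply: ket_sums_big => n _.
have [Pjn | nPjn] := pselect (P (j - n)).
  by apply: ket_sumsZ; exact: ket_sums_ket.
case: (Ba n) => _ ->; first by rewrite scale0r; exact: ket_sums0.
by move=> [/(_ Pj)].
Qed.

Section Invariant.
Variable V : set (ket_space R).
Hypothesis V_inv : invariant_subspace hbar delta (Ahbar hbar F f) V.

Lemma invariant_ket_succ n : c n <> 0 -> V (ket R n) -> V (ket R (n + 1)).
Proof.
case: V_inv => _ _ VZ VA /eqP cn Vn.
have /(VZ (c n)^-1) : V (ket_act hbar delta (Aplus hbar f) (ket R n)).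
  by apply: VA => // A [_]; apply; left.
by rewrite Aplus_ket scalerA mulVf // scale1r.
Qed.

Lemma invariant_ket_pred n : c n <> 0 -> V (ket R (n + 1)) -> V (ket R n).
Proof.
case: V_inv => _ _ VZ VA /eqP cn Vn.
have /(VZ (c n)^-1) : V (ket_act hbar delta (Aminus hbar f) (ket R (n + 1))).
  by apply: VA => // A [_]; apply; right.
rewrite Aminus_ket addrK.
have -> : (n + 1)%:~R - 2^-1 + delta = n%:~R + 2^-1 + delta :> R.
  by rewrite rmorphD /=; field.
by rewrite scalerA mulVf // scale1r.
Qed.

(** Both ladder operators have the same weight on an edge, so a nonzero weight can be crossed either
    way; the equivalence lets the starting ket sit at either end. *)
Lemma invariant_ket_interval (m n : int) :
  m <= n -> (forall j : int, m <= j -> j < n -> c j <> 0) ->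
  V (ket R m) <-> V (ket R n).
Proof.
move=> mn; have -> : n = m + `|n - m|%N by lia.
elim: `|n - m|%N => [|d IH] cj; first by rewrite addr0.
have -> : m + d.+1 = m + d + 1 by lia.
have cmd : c (m + d) <> 0 by apply: cj; lia.
apply: (iff_trans (IH _)) => [j mj jd|]; first by apply: cj; lia.
by split; [exact: invariant_ket_succ | exact: invariant_ket_pred].
Qed.

End Invariant.

Lemma ket_moduleE (P : set int) (k : int) :
  star_subalgebra F -> hbar_invariant hbar F ->
  F (fun u => f (u + 2^-1 * hbar)) -> F (fun u => f (u - 2^-1 * hbar)) ->
  (forall n, ~ (P n <-> P (n + 1)) -> c n = 0) -> P k ->
  (forall n j : int, P n -> k <= j < n \/ n <= j < k -> c j <> 0) ->
  ket_module hbar delta F f k = @ket_sums R P.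
Proof.
move=> F_alg F_inv Fp Fm cP Pk cj.
apply/seteqP; split; first exact: ket_module_sub.
move=> v Pv V [V_inv Vk]; case: (V_inv) => V0 VD VZ _.
apply: (ket_sums_sub V0 VD VZ _ Pv) => n Pn.
have {}Vk : V (ket R k) by exact: Vk.
have [kn | nk] := leP k n.
  apply: (invariant_ket_interval V_inv kn _).1 Vk => j kj jn.
  by apply: (cj n) => //; left; apply/andP.
apply: (invariant_ket_interval V_inv (ltW nk) _).2 Vk => j nj jk.
by apply: (cj n) => //; right; apply/andP.
Qed.

End KetModule.

Theorem proposition4p3 (R : realType) (hbar delta : R)
    (F : set (R -> R[i])) (f : R -> R[i])
    (hbar_gt0 : 0 < hbar)
    (F_alg : star_subalgebra F)
    (F_inv : hbar_invariant hbar F)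
    (F_sep : separates_points F)
    (Ff : F f)
    (Ff_plus : F (fun u => f (u + 2^-1 * hbar)))
    (Ff_minus : F (fun u => f (u - 2^-1 * hbar))) :
  (forall N : int,
     f ((N%:~R + 2^-1 + delta) * hbar) = 0 ->
     (forall n : int, n < N -> f ((n%:~R + 2^-1 + delta) * hbar) <> 0) ->
     ket_module hbar delta F f N = @ket_sums R [set n : int | n <= N]) /\
  (forall M : int,
     f ((M%:~R - 2^-1 + delta) * hbar) = 0 ->
     (forall n : int, M < n -> f ((n%:~R - 2^-1 + delta) * hbar) <> 0) ->
     ket_module hbar delta F f M = @ket_sums R [set n : int | M <= n]) /\
  (forall M N : int,
     M < N ->
     f ((M%:~R - 2^-1 + delta) * hbar) = 0 ->
     f ((N%:~R + 2^-1 + delta) * hbar) = 0 ->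
     (forall n : int, M <= n -> n < N ->
        f ((n%:~R + 2^-1 + delta) * hbar) <> 0) ->
     ket_module hbar delta F f M = ket_module hbar delta F f N /\
     ket_module hbar delta F f N = @ket_sums R [set n : int | M <= n <= N]).
Proof.
have shiftE (n : int) :
    (n%:~R - 2^-1 + delta) * hbar = ((n - 1)%:~R + 2^-1 + delta) * hbar.
  by rewrite rmorphB /=; congr (_ * _); field.
split; [|split].
- move=> N cN cn; apply: ket_moduleE => //=.
  + move=> n nP; suff -> : n = N by [].
    by apply: contra_notP nP => /eqP nN; split; lia.
  + by move=> n j nN jn; apply: cn; lia.
- move=> M; rewrite shiftE => cM cn; apply: ket_moduleE => //=.
  (* The only edge leaving the half-line is the one from M-1 to M, where [shiftE] places the zero of
     f. *)
  + move=> n nP; suff -> : n = M - 1 by [].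
    by apply: contra_notP nP => /eqP nM; split; lia.
  + move=> n j nM jn; have := cn (j + 1); rewrite shiftE addrK; apply; lia.
- move=> M N MN; rewrite shiftE => cM cN cn.
  have bdry (n : int) : ~ (M <= n <= N <-> M <= n + 1 <= N) ->
      f ((n%:~R + 2^-1 + delta) * hbar) = 0.
    move=> nP; have [-> // | /eqP nN] := pselect (n = N).
    suff -> : n = M - 1 by [].
    by apply: contra_notP nP => /eqP nM; split; lia.
  (* Either endpoint reaches the whole interval, so the two modules agree by having the same
     span. *)
  have modE (k : int) : k = M \/ k = N ->
      ket_module hbar delta F f k = @ket_sums R [set n : int | M <= n <= N].
    move=> kMN; apply: ket_moduleE => //=; first by lia.
    by move=> n j nMN jn; apply: cn; lia.
  by rewrite !modE; [|right|left].
Qed.
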